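(* Let $\tau$ and $\rho$ be patterns, regarded as subword (consecutive) patterns, each having largest letter $s$, and suppose $\tau\sim\rho$ as subword patterns. Let $\sigma$ be a non-empty monotonic pattern (its letters are weakly increasing or weakly decreasing), regarded as a subword pattern, with largest letter $t$. Then $$\tau\text{-}(\sigma+s)\sim \rho\text{-}(\sigma+s)\qquad\text{and}\qquad \sigma\text{-}(\tau+t)\sim \sigma\text{-}(\rho+t).$$
   Context: For $k\ge1$ let $[k]=\{1,\dots,k\}$; a $k$-ary word of length $n$ is an element of $[k]^n$. A pattern is a word $\sigma=\sigma_1\cdots\sigma_m\in[\ell]^m$ in which every letter of $[\ell]$ occurs. Two words are order-isomorphic if replacing the $i$-th smallest distinct letter by $i$ yields the same word. A vincular pattern is a pair $(\sigma,X)$ with $\sigma$ a pattern of length $m$ and $X\subseteq[m-1]$; it is written as $\sigma$ with a dash ''-'' inserted between $\sigma_j$ and $\sigma_{j+1}$ exactly when $j\notin X$. A word $w=w_1\cdots w_n$ contains $(\sigma,X)$ if there are indices $i_1<\dots<i_m$ with $w_{i_1}\cdots w_{i_m}$ order-isomorphic to $\sigma$ and $i_{j+1}=i_j+1$ for all $j\in X$; otherwise $w$ avoids it. A subword (consecutive) pattern is one with $X=[m-1]$ (no dashes). Let $a_\sigma(n,k)$ be the number of words in $[k]^n$ avoiding $\sigma$; patterns $\sigma,\tau$ are Wilf-equivalent, $\sigma\sim\tau$, if $a_\sigma(n,k)=a_\tau(n,k)$ for all $n\ge0$, $k\ge1$. For a pattern $\sigma$ and integer $s$, $\sigma+s$ denotes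 the word obtained by adding $s$ to every letter. For subword patterns $\alpha,\beta$, $\alpha\text{-}\beta$ denotes the vincular pattern whose underlying word is the concatenation $\alpha\beta$, with adjacency required between consecutive letters inside $\alpha$ and inside $\beta$, and a single dash between the last letter of $\alpha$ and the first of $\beta$. *)

(* Defs.v *)
From mathcomp Require Import all_boot zify.
Set Implicit Arguments.
Unset Strict Implicit.
Unset Printing Implicit Defensive.

(* Words are sequences of natural numbers; the letters of [k] are 1, ..., k. *)
Definition is_pattern (u : seq nat) : Prop :=
  exists l : nat, u =i iota 1 l.

Definition largest_letter (u : seq nat) (s : nat) : bool :=
  (s \in u) && all (fun x => x <= s) u.

Definition monotonic (u : seq nat) : bool := sorted leq u || sorted geq u.

(* Replaces the i-th smallest distinct letter of u by i (i = 1, 2, ...). *)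
Definition reduction (u : seq nat) : seq nat :=
  [seq (index x (sort leq (undup u))).+1 | x <- u].

Definition order_iso (u v : seq nat) : bool := reduction u == reduction v.

(* A pair (sigma, X), where X lists 1-based positions j such that the letters
   sigma_j and sigma_(j+1) must be matched by adjacent letters. *)
Record vincular := Vincular { vword : seq nat; vadj : seq nat }.

Definition is_vincular (p : vincular) : Prop :=
  is_pattern (vword p) /\ all (fun j => 0 < j < size (vword p)) (vadj p).

(* The positions i_1 < ... < i_m in w are 0-based, and i_j is the entry of
   index j.-1 of the tuple i. *)
Definition contains (p : vincular) (w : seq nat) : bool :=
  [exists i : (size (vword p)).-tuple 'I_(size w),
    let pos := map val i in
    [&& sorted ltn pos,
        order_iso [seq nth 0 w a | a <- pos] (vword p)
      & all (fun j => nth 0 pos j == (nth 0 pos j.-1).+1) (vadj p)]].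

Definition avoids (p : vincular) (w : seq nat) : bool := ~~ contains p w.

(* An element of [k]^n is a tuple over 'I_k = {0, ..., k-1}, whose letters are
   shifted by one. *)
Definition avoid_count (p : vincular) (n k : nat) : nat :=
  #|[set w : n.-tuple 'I_k | avoids p [seq (val x).+1 | x <- w]]|.

Definition wilf_equiv (p q : vincular) : Prop :=
  forall n k : nat, 1 <= k -> avoid_count p n k = avoid_count q n k.

Definition subword (u : seq nat) : vincular :=
  Vincular u (iota 1 (size u).-1).

Definition dash (u v : seq nat) : vincular :=
  Vincular (u ++ v) (iota 1 (size u).-1 ++ iota (size u).+1 (size v).-1).

Definition shift (u : seq nat) (s : nat) : seq nat := [seq x + s | x <- u].

Lemma is_vincular_subword (u : seq nat) :
  is_pattern u -> is_vincular (subword u).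
Proof.
by move=> pu; split=> //=; apply/allP=> j; rewrite mem_iota; lia.
Qed.

Lemma is_vincular_dash (u v : seq nat) (s : nat) :
  is_pattern u -> largest_letter u s -> is_pattern v -> 0 < size v ->
  is_vincular (dash u (shift v s)).
Proof.
move=> [l ul] /andP[su /allP us] [l' vl] v0; split; last first.
  have u0 : 0 < size u by case: (u) su.
  by apply/allP=> j /=; rewrite mem_cat !mem_iota size_cat size_map; lia.
have els : l = s.
  have : s \in iota 1 l by rewrite -ul.
  rewrite mem_iota => sl.
  have : l <= s by apply: us; rewrite ul mem_iota; lia.
  lia.
exists (s + l') => x; rewrite /= mem_cat ul els iotaD mem_cat; congr (_ || _).
apply/mapP/idP=> [[y]|]; first by rewrite vl !mem_iota => hy ->; lia.
rewrite mem_iota => hx.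
by exists (x - s); [rewrite vl mem_iota; lia | lia].
Qed.

(* Main.v *)
Require Import Defs.
From mathcomp Require Import all_boot zify.

(** Read a word from right to left. Once a suffix [v] is known, let [a] be the
    largest bound such that [sigma] occurs in [v] in letters exceeding [a]; an
    occurrence of [tau] ending just before [v] is forbidden exactly when its
    letters are all [<= a]. Letters [<= a] neither change [a] nor take part in
    later occurrences of [sigma] that matter, so in a word [u c r v], with [r] a
    run of letters [<= a] and [c > a], the only constraint on [r] is to avoid
    [tau] over the alphabet [[a]], and the constraint on [u] depends on [r] only
    through its length. This gives a recursion for the number of avoiders in
    which [tau] enters only through its avoidance numbers as a subword pattern.
    Reversal and complement turn the second equivalence into the first. *)

Set Implicit Arguments.
Unset Strict Implicit.
Unset Printing Implicit Defensive.

(** * Order isomorphism and the reverse complement *)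

Lemma leq_index_sort_undup (u : seq nat) :
  {in u &, forall x y, (index x (sort leq (undup u)) <=
                        index y (sort leq (undup u))) = (x <= y)}.
Proof.
set q := sort leq (undup u) => x y xu yu.
have qs : sorted leq q by apply: sort_sorted; exact: leq_total.
have qE z : (z \in q) = (z \in u) by rewrite mem_sort mem_undup.
have mono a b : a \in u -> b \in u -> index a q <= index b q -> a <= b.
  move=> au bu; apply: (sorted_leq_index leq_trans leqnn qs);
    by rewrite qE.
apply/idP/idP; first exact: mono.
move=> xy; rewrite leqNgt; apply/negP => lt_yx.
have yx := mono _ _ yu xu (ltnW lt_yx).
have exy : x = y by apply/eqP; rewrite eqn_leq xy.
by rewrite exy ltnn in lt_yx.
Qed.

(** Sorting the distinct letters commutes with a map that preserves order on [u], so every letter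
    keeps its rank. *)
Lemma reduction_map (f : nat -> nat) (u : seq nat) :
  {in u &, {mono f : x y / x <= y}} -> reduction (map f u) = reduction u.
Proof.
move=> fm; have fi : {in u &, injective f}.
  move=> x y xu yu fxy; apply/eqP.
  by rewrite eqn_leq -(fm x y) // -(fm y x) // fxy leqnn.
have qE z : (z \in sort leq (undup u)) = (z \in u)
  by rewrite mem_sort mem_undup.
have qu : uniq (map f (sort leq (undup u))).
  rewrite map_inj_in_uniq ?sort_uniq ?undup_uniq // => x y.
  by rewrite !qE; apply: fi.
have eqs : sort leq (undup (map f u)) = map f (sort leq (undup u)).
  apply: (sorted_eq leq_trans anti_leq).
  - by apply: sort_sorted; exact: leq_total.
  - have : sorted leq (sort leq (undup u)).
      by apply: sort_sorted; exact: leq_total.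
    apply: (@homo_sorted_in _ _ (mem u) f leq leq); last first.
      by apply/allP => z; rewrite qE.
    by move=> x y xu yu; rewrite fm.
  - apply: uniq_perm => //; first by rewrite sort_uniq undup_uniq.
    move=> z; rewrite mem_sort mem_undup.
    by apply/mapP/mapP => -[x xu ->]; exists x; rewrite ?qE // -qE.
rewrite /reduction -map_comp eqs; apply/eq_in_map => x xu /=; congr _.+1.
have xq : x \in sort leq (undup u) by rewrite qE.
rewrite -{1}(nth_index 0 xq) -(nth_map 0 0) ?index_mem //.
by rewrite index_uniq ?size_map ?index_mem.
Qed.

(** Ranks carry the same information as pairwise comparisons of positions; comparisons are the form
    that splits along concatenations and follows reversal. *)
Lemma order_isoP (u v : seq nat) :
  reflect (size u = size v /\
           forall i j, i < size u -> j < size u ->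
             (nth 0 u i <= nth 0 u j) = (nth 0 v i <= nth 0 v j))
          (order_iso u v).
Proof.
apply: (iffP eqP) => [uv | [suv uv]].
  have suv : size u = size v by have := congr1 size uv; rewrite !size_map.
  split=> // i j iu ju.
  have nthE a : a < size u -> index (nth 0 u a) (sort leq (undup u)) =
                              index (nth 0 v a) (sort leq (undup v)).
    move=> au; have := congr1 (nth 0 ^~ a) uv.
    by rewrite !(nth_map 0) -?suv // => -[].
  rewrite -(leq_index_sort_undup (u := u)) ?mem_nth // !nthE //.
  by rewrite leq_index_sort_undup // mem_nth // -suv.
(* [f] sends a letter of [u] to the letter of [v] at its first position in [u]. Equal letters of [u]
   sit over equal letters of [v], so [v] is [map f u], and [f] preserves order on [u]. *)
pose f x := nth 0 v (index x u).
have fE i : i < size u -> f (nth 0 u i) = nth 0 v i.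
  move=> iu; set j := index (nth 0 u i) u.
  have ju : j < size u by rewrite index_mem mem_nth.
  have nj : nth 0 u j = nth 0 u i by rewrite nth_index ?mem_nth.
  by apply/eqP; rewrite eqn_leq /f -/j -!uv // nj leqnn.
have -> : v = map f u.
  apply: (@eq_from_nth _ 0) => [|i]; first by rewrite size_map.
  by rewrite -suv => iu; rewrite (nth_map 0) // fE.
rewrite reduction_map // => x y xu yu.
by rewrite /f -uv ?index_mem // !nth_index.
Qed.

Lemma order_iso_size (u v : seq nat) : order_iso u v -> size u = size v.
Proof. by case/order_isoP. Qed.

(** Letters of [u] are at most [s] and those of [shift v s] exceed [s], so the comparisons between
    the two blocks say exactly that [x] lies below [y]. *)
Lemma order_iso_cat (x y u v : seq nat) (s : nat) :
  all (leq^~ s) u -> all (leq 1) v -> 0 < size u -> 0 < size v ->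
  size x = size u ->
  order_iso (x ++ y) (u ++ shift v s) =
  [&& order_iso x u, order_iso y v & all (fun b => all (ltn^~ b) x) y].
Proof.
move=> /(all_nthP 0) us /(all_nthP 0) v1 u0 v0 sx.
have svn i : i < size v -> nth 0 (shift v s) i = nth 0 v i + s.
  by move=> iv; rewrite (nth_map 0).
apply/order_isoP/and3P => [[] | [/order_isoP[_ xu] /order_isoP[sy yv] xy]].
  rewrite !size_cat size_map => sz H.
  have {sz} sy : size y = size v by lia.
  split.
  - apply/order_isoP; split=> // i j ix jx.
    by have := H i j; rewrite !nth_cat -sx ix jx; apply; lia.
  - apply/order_isoP; split=> // i j iy jy.
    have := H (size x + i) (size x + j).
    rewrite !nth_cat -sx !ltnNge !leq_addr /= !addKn !svn -?sy //.
    by rewrite leq_add2r; apply; lia.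
  - apply/(all_nthP 0) => j jy; apply/(all_nthP 0) => i ix.
    have := H (size x + j) i.
    rewrite !nth_cat -sx ix !ltnNge !leq_addr /= !addKn svn -?sy //.
    have := us i; have := v1 j; rewrite -sx -sy; lia.
split; first by rewrite !size_cat size_map; lia.
rewrite size_cat sx => i j ilt jlt; rewrite !nth_cat sx.
have xyE a b : a < size u -> b < size v -> nth 0 x a < nth 0 y b.
  move=> au bv; move/(all_nthP 0): xy => /(_ b); rewrite sy => /(_ bv).
  by move/(all_nthP 0)/(_ a); rewrite sx; apply.
case: ltnP => iu; case: ltnP => ju.
- by apply: xu; rewrite sx.
- rewrite svn; last lia.
  have := @xyE i (j - size u); have := us i; have := v1 (j - size u).
  lia.
- rewrite svn; last lia.
  have := @xyE j (i - size u); have := us j; have := v1 (i - size u).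
  lia.
- rewrite !svn; try lia.
  by rewrite leq_add2r; apply: yv; lia.
Qed.

(** Subtraction truncates, so the complement reverses order only on letters up to [k.+1]; hence the
    bounds on letters carried along below. *)
Definition revcomp (k : nat) (u : seq nat) : seq nat :=
  rev [seq k.+1 - x | x <- u].

Lemma size_revcomp (k : nat) (u : seq nat) : size (revcomp k u) = size u.
Proof. by rewrite size_rev size_map. Qed.

Lemma revcompK (k : nat) (u : seq nat) :
  all (leq^~ k) u -> revcomp k (revcomp k u) = u.
Proof.
move=> /allP uk; rewrite /revcomp map_rev revK -map_comp map_id_in //.
by move=> x /uk /=; lia.
Qed.

Lemma order_iso_revcomp (k s : nat) (u v : seq nat) :
  all (leq^~ k) u -> all (leq^~ s) v -> order_iso u v ->
  order_iso (revcomp k u) (revcomp s v).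
Proof.
move=> /(all_nthP 0) uk /(all_nthP 0) vs /order_isoP[suv uv].
apply/order_isoP; split; first by rewrite !size_revcomp.
rewrite size_revcomp => i j ilt jlt.
rewrite !nth_rev ?size_map -?suv //.
set a := size u - _; set b := size u - _.
have au : a < size u by lia.
have bu : b < size u by lia.
rewrite !(nth_map 0) -?suv //.
(* Complementing reverses each comparison, which is why [b] and [a] are swapped. *)
have := uv b a bu au; have := uk a au; have := uk b bu.
move: (vs a) (vs b); rewrite -suv => /(_ au) + /(_ bu); lia.
Qed.

(** * Words as lists, and sums over them decomposed from the right *)

Fixpoint words (k n : nat) : seq (seq nat) :=
  if n is m.+1 then [seq rcons u x | x <- iota 1 k, u <- words k m]
  else [:: [::]].

Lemma mem_words (k n : nat) (w : seq nat) :
  (w \in words k n) = (size w == n) && all (fun x => 0 < x <= k) w.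
Proof.
elim: n w => [|n IHn] w /=; first by rewrite inE size_eq0; case: w.
apply/allpairsP/idP => [[[x u]] /= [] | ].
  rewrite mem_iota IHn => xk /andP[/eqP su uk] ->.
  by rewrite size_rcons su eqxx all_rcons uk; lia.
case/lastP: w => [|u x] //; rewrite size_rcons eqSS all_rcons.
move=> /and3P[su xk uk]; exists (x, u); split=> //=.
  by rewrite mem_iota; lia.
by rewrite IHn su.
Qed.

Lemma uniq_words (k n : nat) : uniq (words k n).
Proof.
elim: n => //= n IHn; apply: allpairs_uniq => //; first exact: iota_uniq.
by move=> [x u] [y v] _ _ /= /rcons_inj[-> ->].
Qed.

Lemma avoid_count_words (p : vincular) (n k : nat) :
  avoid_count p n k = \sum_(w <- words k n) avoids p w.
Proof.
pose f (w : n.-tuple 'I_k) := [seq (val x).+1 | x <- w].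
have injf : injective f.
  by move=> u v /inj_map uv; apply/val_inj/uv => i j [] /val_inj.
rewrite (perm_big [seq f w | w <- index_enum (n.-tuple 'I_k)]); last first.
  apply: uniq_perm; rewrite ?uniq_words ?map_inj_uniq ?index_enum_uniq // => w.
  rewrite mem_words; apply/andP/mapP => [[/eqP sw wk] | [u _ ->]].
    (* Over an empty alphabet [insubd] has no default letter, but then only the empty word
       remains. *)
    case: (posnP k) => [k0 | k0].
      case: w sw wk => [|x w] /= sw wk; last by case/andP: wk; lia.
      have st : size ([::] : seq 'I_k) == n by rewrite -sw.
      by exists (Tuple st); rewrite ?mem_index_enum.
    have st : size [seq insubd (Ordinal k0) x.-1 | x <- w] == n
      by rewrite size_map sw.
    exists (Tuple st); rewrite ?mem_index_enum // /f /= -map_comp map_id_in //.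
    move=> x /(allP wk) xk /=; rewrite val_insubd.
    by case: ltnP; lia.
  rewrite size_map size_tuple; split=> //; apply/allP => _ /mapP[i _ ->].
  by rewrite /= ltn_ord.
rewrite big_map /avoid_count -sum1_card big_mkcond /=.
by apply: eq_bigr => w _; rewrite inE; case: (avoids _ _).
Qed.

Lemma sum_words_recr (k n : nat) (f : seq nat -> nat) :
  \sum_(w <- words k n.+1) f w =
  \sum_(x <- iota 1 k) \sum_(u <- words k n) f (rcons u x).
Proof. exact: big_allpairs_dep. Qed.

(* Splits a word at its last letter exceeding [a]. *)
Lemma sum_words_split (a k m : nat) (f : seq nat -> nat) : a <= k ->
  \sum_(w <- words k m) f w =
  \sum_(w <- words a m) f w +
  \sum_(j < m) \sum_(x <- iota a.+1 (k - a)) \sum_(r <- words a j)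
    \sum_(u <- words k (m.-1 - j)) f (u ++ x :: r).
Proof.
move=> ak; elim: m f => [|m IHm] f; first by rewrite big_ord0 addn0.
(* Peel off the last letter. If it exceeds [a], it is the letter sought and gives the term [j = 0]
   with an empty run; otherwise it extends the run found by induction in the rest. *)
rewrite !sum_words_recr -{1}(subnKC ak) iotaD big_cat /= add1n.
under eq_bigr => y _ do rewrite IHm.
rewrite big_split /= -addnA; congr (_ + _).
rewrite big_ord_recl addnC /=; congr (_ + _).
  apply: eq_bigr => x _; rewrite big_seq1 subn0.
  by apply: eq_bigr => u _; rewrite cats1.
rewrite exchange_big; apply: eq_bigr => j _ /=.
rewrite exchange_big; apply: eq_bigr => x _ /=.
rewrite sum_words_recr; apply: eq_bigr => y _; apply: eq_bigr => r _.
have -> : m - bump 0 j = m.-1 - j by rewrite /bump; lia.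
by apply: eq_bigr => u _; rewrite rcons_cat.
Qed.

(** * Occurrences as factors of a word *)

Definition occurs (P : seq nat -> seq nat -> bool) (w : seq nat) : bool :=
  has (fun i => has (fun j => P (take j (drop i w)) (drop j (drop i w)))
    (iota 0 (size w).+1)) (iota 0 (size w).+1).

Lemma occursP (P : seq nat -> seq nat -> bool) (w : seq nat) :
  reflect (exists u x v, w = u ++ x ++ v /\ P x v) (occurs P w).
Proof.
apply: (iffP hasP) => [[i _ /hasP[j _ Pij]] | [u [x [v [-> Pxv]]]]].
  exists (take i w), (take j (drop i w)), (drop j (drop i w)).
  by rewrite !cat_take_drop.
exists (size u); first by rewrite mem_iota !size_cat; lia.
apply/hasP; exists (size x); first by rewrite mem_iota !size_cat; lia.
by rewrite drop_size_cat // take_size_cat // drop_size_cat.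
Qed.

Definition occurs_iso (u w : seq nat) : bool :=
  occurs (fun x _ => order_iso x u) w.

Definition occurs_above (u : seq nat) (b : nat) (w : seq nat) : bool :=
  occurs (fun x _ => order_iso x u && all (ltn b) x) w.

(** Here [w'] is a suffix already read: the first half must lie inside [w], while the second may use
    anything after it in [w ++ w']. The condition that the second half lies above the first is
    carried by the maximum of [x]. *)
Definition occurs_dash (u v w w' : seq nat) : bool :=
  occurs (fun x z =>
    order_iso x u && occurs_above v (\max_(y <- x) y) (z ++ w')) w.

Lemma nth_iota_adjacent (l : seq nat) :
  all (fun j => nth 0 l j == (nth 0 l j.-1).+1) (iota 1 (size l).-1) ->
  l = iota (nth 0 l 0) (size l).
Proof.
move=> /allP adj; apply: (@eq_from_nth _ 0) => [|i il]; rewrite ?size_iota //.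
rewrite nth_iota //; elim: i il => [|i IHi] il; first by rewrite addn0.
rewrite addnS -IHi; last lia.
by apply/eqP/adj; rewrite mem_iota; lia.
Qed.

Lemma containsP (p : vincular) (w : seq nat) :
  reflect (exists pos : seq nat,
             [/\ size pos = size (vword p), all (ltn^~ (size w)) pos,
                 sorted ltn pos,
                 order_iso [seq nth 0 w a | a <- pos] (vword p)
               & all (fun j => nth 0 pos j == (nth 0 pos j.-1).+1) (vadj p)])
          (contains p w).
Proof.
apply: (iffP existsP) => [[i /and3P[ltni iso adj]] | [pos [sp pw lp iso adj]]].
  exists (map val i); split; rewrite ?size_map ?size_tuple //.
  by apply/allP => _ /mapP[a _ ->]; exact: (ltn_ord a).
have [i ei] : exists i : (size (vword p)).-tuple 'I_(size w), map val i = pos.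
  case: (posnP (size w)) => [w0 | w0].
    have p0 : pos = [::] by case: (pos) pw => //= a l; rewrite w0.
    rewrite p0 /= in sp; rewrite -sp p0; by exists [tuple].
  have st : size [seq insubd (Ordinal w0) a | a <- pos] == size (vword p).
    by rewrite size_map sp.
  exists (Tuple st); rewrite -map_comp map_id_in // => a /(allP pw) /= aw.
  by rewrite val_insubd aw.
by exists i; rewrite ei; apply/and3P.
Qed.

Lemma sorted_iota_cat (a m b n : nat) :
  a + m <= b -> sorted ltn (iota a m ++ iota b n).
Proof.
elim: m a => [|m IHm] a ab /=; first exact: iota_ltn_sorted.
rewrite path_sortedE; last exact: ltn_trans.
rewrite IHm ?andbT; last lia.
by apply/allP => x; rewrite mem_cat !mem_iota /=; lia.
Qed.

Lemma nth_adjacent_iota (a m j : nat) : 0 < j < m ->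
  nth 0 (iota a m) j = (nth 0 (iota a m) j.-1).+1.
Proof. by move=> jm; rewrite !nth_iota; lia. Qed.

Lemma contains_subword (u w : seq nat) :
  contains (subword u) w = occurs_iso u w.
Proof.
apply/containsP/occursP => /= [[pos [sp pw lp iso adj]] | [p [x [q [-> iso]]]]].
  rewrite -sp in adj; have posE := nth_iota_adjacent adj.
  set a := nth 0 pos 0 in posE.
  have aw : size pos <= size w - a.
    case: (posnP (size pos)) => [-> // | p0].
    have : a + (size pos).-1 \in pos by rewrite posE mem_iota size_iota; lia.
    by move=> /(allP pw); lia.
  exists (take a w), (take (size pos) (drop a w)), (drop (size pos) (drop a w)).
  by rewrite !cat_take_drop -(map_nth_iota 0 aw) -posE.
have sx := order_iso_size iso.
exists (iota (size p) (size x)); rewrite size_iota sx; split=> //.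
- by apply/allP => i; rewrite mem_iota !size_cat; lia.
- exact: iota_ltn_sorted.
- rewrite map_nth_iota ?size_cat -?sx; last lia.
  by rewrite drop_size_cat // take_size_cat.
- apply/allP => j; rewrite mem_iota => jm.
  by rewrite nth_adjacent_iota //; lia.
Qed.

(** The adjacency conditions force the chosen positions into two intervals, one per half; [q] is the
    gap that the dash allows. *)
Lemma contains_dashP (u v w : seq nat) : 0 < size u -> 0 < size v ->
  reflect (exists p x q y z, [/\ w = p ++ x ++ q ++ y ++ z, size x = size u
                               & order_iso (x ++ y) (u ++ v)])
          (contains (dash u v) w).
Proof.
move=> u0 v0; apply: (iffP (containsP _ _)) => /=.
  move=> [pos []]; rewrite size_cat all_cat.
  move=> sp /allP pw lp iso /andP[adju adjv].
  set a := nth 0 (take (size u) pos) 0; set b := nth 0 (drop (size u) pos) 0.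
  have stp : size (take (size u) pos) = size u by rewrite size_takel; lia.
  have sdp : size (drop (size u) pos) = size v by rewrite size_drop; lia.
  have tE : take (size u) pos = iota a (size u).
    rewrite -{2}stp; apply: nth_iota_adjacent; rewrite stp.
    apply/allP => j jm; have := allP adju _ jm.
    by move: jm; rewrite mem_iota => jm; rewrite !nth_take; lia.
  (* The adjacency indices of the second half start at [(size u).+1]: the index [size u], where the
     dash stands, is free. *)
  have dE : drop (size u) pos = iota b (size v).
    rewrite -sdp; apply: nth_iota_adjacent; rewrite sdp.
    apply/allP => j; rewrite mem_iota => jm.
    have := allP adjv (size u + j); rewrite mem_iota !nth_drop => H.
    have -> : size u + j.-1 = (size u + j).-1 by lia.
    by apply: H; lia.
  have posE : pos = iota a (size u) ++ iota b (size v).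
    by rewrite -tE -dE cat_take_drop.
  have ab : a + size u <= b.
    have := lp; rewrite posE => /(sorted_ltn_nth ltn_trans 0).
    move=> /(_ (size u).-1 (size u)); rewrite !inE size_cat !size_iota !nth_cat.
    rewrite !size_iota ltnn prednK // leqnn subnn !nth_iota; lia.
  have bw : b + size v <= size w.
    have : b + (size v).-1 \in pos by rewrite posE mem_cat !mem_iota; lia.
    by move=> /pw; lia.
  pose d := b - (a + size u).
  exists (take a w), (take (size u) (drop a w)),
    (take d (drop (size u) (drop a w))),
    (take (size v) (drop d (drop (size u) (drop a w)))),
    (drop (size v) (drop d (drop (size u) (drop a w)))).
  split; first by rewrite !cat_take_drop.
    by rewrite size_takel // size_drop; lia.
  have := iso; rewrite posE map_cat !map_nth_iota; try lia.
  rewrite !drop_drop; have -> // : d + size u + a = b by rewrite /d; lia.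
move=> [p [x [q [y [z [-> sx iso]]]]]].
have sy : size y = size v.
  by have := order_iso_size iso; rewrite !size_cat; lia.
set b := size p + size x + size q.
exists (iota (size p) (size u) ++ iota b (size v)).
split.
- by rewrite !size_cat !size_iota.
- by apply/allP => i; rewrite mem_cat !mem_iota !size_cat /b; lia.
- by apply: sorted_iota_cat; rewrite /b; lia.
- rewrite map_cat !map_nth_iota; try by rewrite !size_cat /b; lia.
  rewrite drop_size_cat // take_size_cat //.
  have -> : p ++ x ++ q ++ y ++ z = (p ++ x ++ q) ++ y ++ z by rewrite !catA.
  rewrite drop_size_cat; last by rewrite !size_cat /b; lia.
  by rewrite take_size_cat.
- rewrite all_cat; apply/andP; split; apply/allP => j; rewrite mem_iota => jm.
    rewrite !nth_cat !size_iota.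
    have -> : j < size u by lia.
    have -> : j.-1 < size u by lia.
    by rewrite nth_adjacent_iota //; lia.
  rewrite !nth_cat !size_iota.
  have -> : (j < size u) = false by lia.
  have -> : (j.-1 < size u) = false by lia.
  have -> : j.-1 - size u = (j - size u).-1 by lia.
  by rewrite nth_adjacent_iota //; lia.
Qed.

Lemma contains_dash_shiftP (u v w : seq nat) (s : nat) :
  all (leq^~ s) u -> all (leq 1) v -> 0 < size u -> 0 < size v ->
  reflect (exists p x q y z,
             [/\ w = p ++ x ++ q ++ y ++ z, order_iso x u, order_iso y v
               & all (fun b => all (ltn^~ b) x) y])
          (contains (dash u (shift v s)) w).
Proof.
move=> us v1 u0 v0; have sv0 : 0 < size (shift v s) by rewrite size_map.
apply: (iffP (contains_dashP _ u0 sv0)) => [] [p [x [q [y [z]]]]].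
  move=> [-> sx]; rewrite order_iso_cat // => /and3P[xu yv xy].
  by exists p, x, q, y, z.
move=> [-> xu yv xy]; exists p, x, q, y, z; have sx := order_iso_size xu.
by split=> //; rewrite order_iso_cat // xu yv xy.
Qed.

Lemma contains_dash_shift (u v w : seq nat) (s : nat) :
  all (leq^~ s) u -> all (leq 1) v -> 0 < size u -> 0 < size v ->
  contains (dash u (shift v s)) w = occurs_dash u v w [::].
Proof.
move=> us v1 u0 v0; have maxE x y :
    order_iso x u -> all (ltn (\max_(a <- x) a)) y =
                     all (fun b => all (ltn^~ b) x) y.
  move=> /order_iso_size xu; apply: eq_in_all => b _.
  apply/idP/allP => [xb a ax | xb].
    by apply: leq_ltn_trans xb; exact: (leq_bigmax_seq a ax).
  (* An empty maximum would be [0] and would not match an empty condition at [b = 0]; [x] has a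
     letter because [u] has one. *)
  have b0 : 0 < b.
    by apply: leq_ltn_trans (xb (nth 0 x 0) _); rewrite ?mem_nth ?xu.
  rewrite /= -(prednK b0) ltnS; apply/bigmax_leqP_seq => a ax _.
  rewrite -ltnS (prednK b0). exact: xb.
apply/(contains_dash_shiftP w us v1 u0 v0)/occursP.
  move=> [p [x [q [y [z [-> xu yv xy]]]]]].
  exists p, x, (q ++ y ++ z); split=> //; rewrite xu cats0 /=.
  by apply/occursP; exists q, y, z; rewrite yv maxE.
move=> [p [x [z' [-> /andP[xu /occursP[q [y [z [+ /andP[yv xy]]]]]]]]]].
by rewrite cats0 => ->; exists p, x, q, y, z; rewrite -maxE.
Qed.

(** * The threshold of a suffix, and letters that do not exceed it *)

(* The largest [b] such that [v] has an occurrence of [sigma] in letters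
   exceeding [b]; it is also [0] when [sigma] does not occur in [v]. *)
Definition threshold (sigma v : seq nat) : nat :=
  \max_(b < (\max_(y <- v) y).+1 | occurs_above sigma b v) b.

Lemma occurs_above_cat (sigma u v : seq nat) (b : nat) :
  occurs_above sigma b v -> occurs_above sigma b (u ++ v).
Proof.
by case/occursP=> p [x [q [-> xs]]]; apply/occursP; exists (u ++ p), x, q;
  rewrite -catA.
Qed.

Lemma occurs_above_leq (sigma v : seq nat) (b c : nat) :
  b <= c -> occurs_above sigma c v -> occurs_above sigma b v.
Proof.
move=> bc /occursP[p [x [q [-> /andP[xs /allP xc]]]]].
apply/occursP; exists p, x, q; rewrite xs; split=> //.
by apply/allP => y /xc; apply: leq_ltn_trans.
Qed.

Lemma occurs_above_cons (sigma v : seq nat) (b y : nat) :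
  0 < size sigma -> y <= b -> occurs_above sigma b (y :: v) ->
  occurs_above sigma b v.
Proof.
move=> s0 yb /occursP[[|z p] [x [q [e /andP[xs xb]]]]].
  have sx := order_iso_size xs.
  case: x e sx {xs} xb => [|z x] /=; first lia.
  by move=> [<- _] _; lia.
by case: e => _ ->; apply/occursP; exists p, x, q; rewrite xs.
Qed.

Lemma occurs_above_leq_threshold (sigma v : seq nat) (b : nat) :
  0 < size sigma -> occurs_above sigma b v -> b <= threshold sigma v.
Proof.
(* The range of the maximum in [threshold] stops at the largest letter of [v]; an occurrence above
   [b] contains a letter exceeding [b], so [b] is in range. *)
move=> s0 bv; have bmax : b < (\max_(y <- v) y).+1.
  case/occursP: (bv) => p [x [q [-> /andP[/order_iso_size xs xb]]]].
  case: x xs xb => [|y x] /= xs; first lia.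
  case/andP=> yb _; apply: leq_trans yb _; apply: leqW.
  by apply: (leq_bigmax_seq y) => //; rewrite !mem_cat mem_head orbT.
exact: (leq_bigmax_cond (Ordinal bmax)).
Qed.

(** Occurring above [b] is inherited by smaller bounds, so all positive values up to the maximum
    qualify. The value [0] is excluded because a threshold of [0] does not tell whether [sigma]
    occurs at all. *)
Lemma threshold_occurs_above (sigma v : seq nat) (b : nat) :
  0 < b <= threshold sigma v -> occurs_above sigma b v.
Proof.
move=> /andP[b0 bt]; case: (boolP (occurs_above sigma b v)) => // nbv.
suff : threshold sigma v < b by lia.
rewrite -(prednK b0) ltnS; apply/bigmax_leqP => c cv.
rewrite -ltnS (prednK b0) ltnNge.
by apply: contra nbv => /occurs_above_leq; apply.
Qed.

(** If [b] exceeded the threshold, no letter of [r] could start an occurrence above [b]; stripping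
    them one by one would leave such an occurrence in [v]. *)
Lemma occurs_above_small_cat (sigma r v : seq nat) (b : nat) :
  0 < size sigma -> all (leq^~ (threshold sigma v)) r ->
  occurs_above sigma b (r ++ v) -> b <= threshold sigma v.
Proof.
move=> s0; elim: r => [|y r IHr] /=.
  by move=> _; exact: occurs_above_leq_threshold.
case/andP=> yt rt occ; case: (leqP b (threshold sigma v)) => // tb.
have := occurs_above_cons s0 _ occ => /(_ (leq_trans yt (ltnW tb))).
by move=> /(IHr rt); lia.
Qed.

(* Letters [<= b] take no part in occurrences above [b]. *)
Lemma occurs_above_mask (sigma w : seq nat) (b : nat) :
  occurs_above sigma b w =
  occurs_above sigma b [seq if y <= b then 0 else y | y <- w].
Proof.
rewrite /occurs_above /occurs size_map.
apply: eq_has => i; apply: eq_has => j; rewrite -map_drop -map_take.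
set x := take _ _.
have -> : all (ltn b) [seq if y <= b then 0 else y | y <- x] = all (ltn b) x.
  by rewrite all_map; apply: eq_all => y /=; case: (leqP y b).
case: (boolP (all (ltn b) x)) => [/allP xb | _]; rewrite ?andbF //.
by rewrite map_id_in // => y /xb /=; case: leqP.
Qed.

(** Up to the threshold, [v] alone already supplies an occurrence on both sides; beyond it, masking
    turns every letter of [r] into [0]. So [r] matters only through its length. *)
Lemma occurs_above_small (sigma u r v : seq nat) (b : nat) :
  0 < b -> all (leq^~ (threshold sigma v)) r ->
  occurs_above sigma b (u ++ r ++ v) =
  occurs_above sigma b (u ++ nseq (size r) 0 ++ v).
Proof.
move=> b0 /allP rt; case: (leqP b (threshold sigma v)) => [bt | tb].
  have bv : occurs_above sigma b v by apply: threshold_occurs_above; rewrite b0.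
  by rewrite !occurs_above_cat.
rewrite occurs_above_mask [RHS]occurs_above_mask !map_cat.
congr (occurs_above _ _ (_ ++ _ ++ _)).
apply: (@eq_from_nth _ 0); rewrite !size_map ?size_nseq // => i ir.
rewrite !(nth_map 0) ?size_nseq // nth_nseq ir /= ifT //.
by apply: leq_trans (ltnW tb); apply: rt; rewrite mem_nth.
Qed.

Lemma order_iso_max_gt0 (tau x : seq nat) :
  0 < size tau -> order_iso x tau -> all (leq 1) x -> 0 < \max_(y <- x) y.
Proof.
move=> t0 /order_iso_size xt; case: x xt => [|y x] /= xt; first lia.
case/andP=> y0 _; apply: leq_trans y0 _.
by apply: (leq_bigmax_seq y); rewrite ?mem_head.
Qed.

(** Any occurrence of [tau] in [r] has its maximum at or below the threshold, so [v] completes it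
    automatically. *)
Lemma occurs_dash_small (tau sigma r v : seq nat) :
  0 < size tau -> all (leq 1) r -> all (leq^~ (threshold sigma v)) r ->
  occurs_dash tau sigma r v = occurs_iso tau r.
Proof.
move=> t0 r1 rt; apply/occursP/occursP => -[p [x [q [er]]]].
  by move=> /andP[xt _]; exists p, x, q.
move=> xt; exists p, x, q; split=> //; rewrite xt; apply/occurs_above_cat.
move: r1 rt; rewrite er !all_cat => /and3P[_ x1 _] /and3P[_ xs _].
apply: threshold_occurs_above; rewrite (order_iso_max_gt0 t0 xt x1) /=.
by apply/bigmax_leqP_seq => y /(allP xs).
Qed.

(* A letter above the threshold cannot belong to the first half of an
   occurrence, so it separates the word into independent pieces. *)
Lemma occurs_dash_cat (tau sigma u r v : seq nat) (c : nat) :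
  0 < size sigma -> threshold sigma v < c ->
  all (leq^~ (threshold sigma v)) r ->
  occurs_dash tau sigma (u ++ c :: r) v =
  occurs_dash tau sigma r v || occurs_dash tau sigma u (c :: r ++ v).
Proof.
move=> s0 tc rt; apply/idP/orP; last first.
  case=> /occursP[p [x [q [-> H]]]]; apply/occursP.
    by exists (u ++ c :: p), x, q; rewrite -catA.
  by exists p, x, (q ++ c :: r); rewrite -!catA.
case/occursP=> p [x [q [e /andP[xt occ]]]].
(* The factor [x] lies before [c], across it, or after it. *)
case: (leqP (size (p ++ x)) (size u)) => [pxu | upx].
  right; apply/occursP; exists p, x, (drop (size (p ++ x)) u).
  have uE : take (size (p ++ x)) u = p ++ x.
    have := congr1 (take (size (p ++ x))) e.
    by rewrite takel_cat // catA take_size_cat.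
  have qE : q = drop (size (p ++ x)) u ++ c :: r.
    have := congr1 (drop (size (p ++ x))) e.
    rewrite drop_cat catA drop_size_cat //; case: ltnP => // upx.
    have -> : size (p ++ x) = size u by apply/eqP; rewrite eqn_leq pxu.
    by rewrite subnn drop_size.
  split; first by rewrite catA -[X in X ++ _]uE cat_take_drop.
  by rewrite xt; move: occ; rewrite qE -catA.
case: (leqP (size p) (size u)) => [pu | up].
  (* If [x] contained [c], the letters between [x] and [v] would form a suffix of [r], all small. An
     occurrence of [sigma] after [x] would then force the maximum of [x], hence [c], down to the
     threshold. *)
  exfalso.
  have cx : c \in x.
    have := congr1 (nth 0 ^~ (size u)) e.
    rewrite /= !nth_cat ltnn subnn /= ltnNge pu /=.
    have sux : size u - size p < size x by move: upx; rewrite size_cat; lia.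
    by rewrite sux => ->; rewrite mem_nth.
  have qr : q = drop (size r - size q) r.
    have := congr1 (drop (size (p ++ x))) e.
    rewrite (catA p) [X in _ = X -> _]drop_size_cat //.
    have -> : size (p ++ x) = (size u + (size r - size q)).+1.
      have := congr1 size e; move: upx; rewrite !size_cat /=; lia.
    by rewrite -addnS drop_cat ltnNge leq_addr addKn /= => ->.
  have : \max_(y <- x) y <= threshold sigma v.
    apply: (occurs_above_small_cat (r := q)) => //.
    by rewrite qr; apply/allP => y /mem_drop /(allP rt).
  have : c <= \max_(y <- x) y by apply: (leq_bigmax_seq c).
  lia.
left; apply/occursP; exists (drop (size u).+1 p), x, q; rewrite xt; split=> //.
have := congr1 (drop (size u).+1) e.
rewrite drop_cat ltnNge leqnSn /= subSnn /= drop0 drop_cat.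
move: up; rewrite leq_eqVlt => /orP[/eqP -> | ->] //.
by rewrite ltnn subnn drop0 drop_size.
Qed.

(** The bounds tested are maxima of nonempty factors of [u], hence positive, so zeros can stand for
    the run. The new suffix then depends on [r] only through its length, which decouples [u] from
    [r]. *)
Lemma occurs_dash_context (tau sigma u r v : seq nat) (c : nat) :
  0 < size tau -> all (leq 1) u -> all (leq^~ (threshold sigma v)) r ->
  occurs_dash tau sigma u (c :: r ++ v) =
  occurs_dash tau sigma u (c :: nseq (size r) 0 ++ v).
Proof.
move=> t0 u1 rt.
have H p x q : u = p ++ x ++ q -> order_iso x tau ->
    occurs_above sigma (\max_(y <- x) y) (q ++ c :: r ++ v) =
    occurs_above sigma (\max_(y <- x) y) (q ++ c :: nseq (size r) 0 ++ v).
  move=> uE xt; rewrite -!cat_rcons; apply: occurs_above_small => //.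
  apply: (order_iso_max_gt0 t0 xt).
  by move: u1; rewrite uE !all_cat => /and3P[].
apply/occursP/occursP => -[p [x [q [uE /andP[xt occ]]]]];
  by exists p, x, q; rewrite xt; move: occ; rewrite (H _ _ _ uE xt).
Qed.

(** * The recursion and the equality of the counts *)

Lemma sum_avoid_dash_recr (tau sigma v : seq nat) (k m : nat) :
  0 < size tau -> 0 < size sigma ->
  let a := minn (threshold sigma v) k in
  \sum_(w <- words k m) ~~ occurs_dash tau sigma w v =
  \sum_(w <- words a m) ~~ occurs_iso tau w +
  \sum_(j < m) \sum_(c <- iota a.+1 (k - a))
    (\sum_(r <- words a j) ~~ occurs_iso tau r) *
    \sum_(u <- words k (m.-1 - j))
      ~~ occurs_dash tau sigma u (c :: nseq j 0 ++ v).
Proof.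
move=> t0 s0 a; have le_a_t : a <= threshold sigma v by exact: geq_minl.
have wordsE j l w : w \in words l j ->
    [/\ size w = j, all (leq 1) w & all (leq^~ l) w].
  rewrite mem_words => /andP[/eqP sw /allP wl].
  by split=> //; apply/allP => y /wl /andP[].
have small w j : w \in words a j -> all (leq^~ (threshold sigma v)) w.
  case/wordsE=> _ _; apply: sub_all => y ya; exact: leq_trans le_a_t.
(* The cut is made at the last letter [c] above [a]. If there is none, only [tau] has to be avoided;
   otherwise the conditions on [r] and on [u] are independent and the counts multiply. *)
rewrite (sum_words_split _ _ (geq_minr (threshold sigma v) k)) -/a.
congr (_ + _).
  rewrite big_seq [RHS]big_seq; apply: eq_bigr => w wa.
  have [_ w1 _] := wordsE _ _ _ wa.
  by rewrite occurs_dash_small // (small w m).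
apply: eq_bigr => j _; rewrite big_seq [RHS]big_seq.
apply: eq_bigr => c; rewrite mem_iota => cak.
(* Here [a < c <= k], so the minimum [a] is the threshold itself. *)
have tc : threshold sigma v < c by move: cak; rewrite /a; lia.
rewrite big_distrl /= big_seq [RHS]big_seq; apply: eq_bigr => r ra.
have [sr r1 _] := wordsE _ _ _ ra; have rt := small _ _ ra.
rewrite big_distrr /= big_seq [RHS]big_seq; apply: eq_bigr => u uk.
have [_ u1 _] := wordsE _ _ _ uk.
rewrite occurs_dash_cat // occurs_dash_small // occurs_dash_context // sr.
by rewrite negb_or mulnb.
Qed.

(** Both counts obey the same recursion. The induction on length is uniform in [v], since each step
    lengthens the suffix, while [sigma] and [k] stay fixed. *)
Lemma sum_avoid_dash_eq (tau rho sigma v : seq nat) (k m : nat) :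
  0 < size tau -> 0 < size rho -> 0 < size sigma ->
  (forall a n, \sum_(w <- words a n) ~~ occurs_iso tau w =
               \sum_(w <- words a n) ~~ occurs_iso rho w) ->
  \sum_(w <- words k m) ~~ occurs_dash tau sigma w v =
  \sum_(w <- words k m) ~~ occurs_dash rho sigma w v.
Proof.
move=> t0 r0 s0 tr; elim/ltn_ind: m v => m IHm v.
rewrite !sum_avoid_dash_recr //= tr; congr (_ + _).
apply: eq_bigr => j _; apply: eq_bigr => c _; rewrite tr; congr (_ * _).
by apply: IHm; have := ltn_ord j; lia.
Qed.

Lemma wilf_equiv_dash_shift (tau rho sigma : seq nat) (s : nat) :
  0 < size tau -> 0 < size rho -> 0 < size sigma ->
  all (leq^~ s) tau -> all (leq^~ s) rho -> all (leq 1) sigma ->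
  wilf_equiv (subword tau) (subword rho) ->
  wilf_equiv (dash tau (shift sigma s)) (dash rho (shift sigma s)).
Proof.
move=> t0 r0 s0 ts rs s1 tr n k _; rewrite !avoid_count_words.
rewrite /avoids; under eq_bigr => w _ do rewrite contains_dash_shift //.
under [RHS]eq_bigr => w _ do rewrite contains_dash_shift //.
apply: sum_avoid_dash_eq => // -[|a] l.
  (* A threshold of [0] brings in the empty alphabet, which Wilf equivalence does not cover; its
     only possible word is empty and avoids both nonempty patterns. *)
  apply: eq_big_seq => w; rewrite mem_words => /andP[_].
  case: w => [_ | x w /=]; last by case: x.
  have nil p : 0 < size p -> occurs_iso p [::] = false.
    move=> p0; apply/negbTE/negP => /occursP[[|? ?] [[|? ?] [q [//= _]]]].
    by move/order_iso_size=> /=; lia.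
  by rewrite !nil.
have := tr l a.+1 isT; rewrite !avoid_count_words /avoids.
under eq_bigr => w _ do rewrite contains_subword.
by under [X in _ = X -> _]eq_bigr => w _ do rewrite contains_subword.
Qed.

(** * Invariance of avoidance counts under reverse complement *)

Lemma revcomp_cat (k : nat) (u v : seq nat) :
  revcomp k (u ++ v) = revcomp k v ++ revcomp k u.
Proof. by rewrite /revcomp map_cat rev_cat. Qed.

Lemma all_revcomp (k : nat) (u : seq nat) :
  all (fun x => 0 < x <= k) u -> all (fun x => 0 < x <= k) (revcomp k u).
Proof.
move=> uk; rewrite all_rev all_map; apply: sub_all uk => x /=; lia.
Qed.

Lemma all_range_leq (k : nat) (u : seq nat) :
  all (fun x => 0 < x <= k) u -> all (leq^~ k) u.
Proof. by apply: sub_all => x /andP[]. Qed.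

Lemma all_range_pos (k : nat) (u : seq nat) :
  all (fun x => 0 < x <= k) u -> all (leq 1) u.
Proof. by apply: sub_all => x /andP[]. Qed.

Lemma sum_words_revcomp (k n : nat) (f : seq nat -> nat) :
  \sum_(w <- words k n) f w = \sum_(w <- words k n) f (revcomp k w).
Proof.
have rcW w : w \in words k n -> revcomp k w \in words k n.
  rewrite !mem_words size_revcomp => /andP[->]; exact: all_revcomp.
have rcK : {in words k n, cancel (revcomp k) (revcomp k)}.
  by move=> w; rewrite mem_words => /andP[_ /all_range_leq /revcompK].
rewrite -(big_map (revcomp k) predT); apply/perm_big/uniq_perm.
- exact: uniq_words.
- by rewrite map_inj_in_uniq ?uniq_words //; exact: can_in_inj rcK.
- move=> w; apply/idP/mapP => [wW | [u uW ->]]; last exact: rcW.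
  by exists (revcomp k w); rewrite ?rcK ?rcW.
Qed.

Lemma avoid_count_revcomp (p q : vincular) (n k : nat) :
  (forall w, all (fun x => 0 < x <= k) w ->
     contains p w -> contains q (revcomp k w)) ->
  (forall w, all (fun x => 0 < x <= k) w ->
     contains q w -> contains p (revcomp k w)) ->
  avoid_count p n k = avoid_count q n k.
Proof.
move=> pq qp; rewrite !avoid_count_words [RHS]sum_words_revcomp.
apply: eq_big_seq => w; rewrite mem_words => /andP[_ wk].
congr (nat_of_bool (~~ _)).
apply/idP/idP; first exact: pq.
by move/(qp _ (all_revcomp wk)); rewrite revcompK // all_range_leq.
Qed.

Lemma avoid_count_subword_revcomp (u : seq nat) (s n k : nat) :
  all (fun x => 0 < x <= s) u ->
  avoid_count (subword (revcomp s u)) n k = avoid_count (subword u) n k.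
Proof.
have imp (v w : seq nat) : all (fun x => 0 < x <= s) v ->
    all (fun x => 0 < x <= k) w -> contains (subword v) w ->
    contains (subword (revcomp s v)) (revcomp k w).
  rewrite !contains_subword => /all_range_leq vs /all_range_leq wk.
  case/occursP=> p [x [q [ew xv]]]; move: wk; rewrite ew !all_cat.
  case/and3P=> _ xk _; apply/occursP.
  exists (revcomp k q), (revcomp k x), (revcomp k p).
  by rewrite !revcomp_cat catA; split=> //; exact: order_iso_revcomp.
move=> us; apply: avoid_count_revcomp => w wk; last exact: imp.
by move/(imp _ _ (all_revcomp us) wk); rewrite revcompK // all_range_leq.
Qed.

(** Reversal exchanges the two halves and complement exchanges which of them is lower, so the lower
    half comes first again. *)
Lemma avoid_count_dash_revcomp (u v : seq nat) (s t n k : nat) :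
  0 < size u -> 0 < size v ->
  all (fun x => 0 < x <= s) u -> all (fun x => 0 < x <= t) v ->
  avoid_count (dash (revcomp t v) (shift (revcomp s u) t)) n k =
  avoid_count (dash u (shift v s)) n k.
Proof.
move=> u0 v0 us vt.
have imp (a b w : seq nat) (l m : nat) : 0 < size a -> 0 < size b ->
    all (fun x => 0 < x <= l) a -> all (fun x => 0 < x <= m) b ->
    all (fun x => 0 < x <= k) w -> contains (dash a (shift b l)) w ->
    contains (dash (revcomp m b) (shift (revcomp l a) m)) (revcomp k w).
  move=> a0 b0 al bm /all_range_leq wk.
  case/(contains_dash_shiftP w (all_range_leq al) (all_range_pos bm) a0 b0).
  move=> p [x [q [y [z [ew xa yb xy]]]]].
  move: wk; rewrite ew !all_cat => /and5P[_ xk _ yk _].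
  apply/contains_dash_shiftP; rewrite ?size_revcomp //.
  - exact: all_range_leq (all_revcomp bm).
  - exact: all_range_pos (all_revcomp al).
  exists (revcomp k z), (revcomp k y), (revcomp k q), (revcomp k x),
    (revcomp k p).
  split.
  - by rewrite !revcomp_cat -!catA.
  - exact: order_iso_revcomp (all_range_leq bm) yb.
  - exact: order_iso_revcomp (all_range_leq al) xa.
  - rewrite /revcomp all_rev all_map; apply/allP => d dx /=.
    rewrite all_rev all_map; apply/allP => c cy /=.
    have := allP (allP xy _ cy) _ dx; have := allP yk _ cy; rewrite /=; lia.
apply: avoid_count_revcomp => w wk; last exact: imp.
(* This direction is [imp] for the reverse-complemented halves, since [revcomp] is an involution on
   them. *)
move/(imp _ _ _ _ _ _ _ (all_revcomp vt) (all_revcomp us) wk).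
rewrite !size_revcomp !revcompK //; try exact: all_range_leq.
by apply.
Qed.

(** * The two equivalences *)

Lemma pattern_range (u : seq nat) (s : nat) :
  is_pattern u -> largest_letter u s -> all (fun x => 0 < x <= s) u.
Proof.
move=> [l ul] /andP[_ /allP us]; apply/allP => x xu; rewrite us // andbT.
by move: xu; rewrite ul mem_iota => /andP[].
Qed.

Theorem theorem2p1 (tau rho sigma : seq nat) (s t : nat) :
  is_pattern tau -> largest_letter tau s ->
  is_pattern rho -> largest_letter rho s ->
  wilf_equiv (subword tau) (subword rho) ->
  is_pattern sigma -> largest_letter sigma t ->
  0 < size sigma -> monotonic sigma ->
  wilf_equiv (dash tau (shift sigma s)) (dash rho (shift sigma s)) /\
  wilf_equiv (dash sigma (shift tau t)) (dash sigma (shift rho t)).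
Proof.
move=> ptau ltau prho lrho tr psigma lsigma s0 _.
have taus := pattern_range ptau ltau; have rhos := pattern_range prho lrho.
have sigmat := pattern_range psigma lsigma.
have t0 : 0 < size tau by case/andP: ltau; case: (tau).
have r0 : 0 < size rho by case/andP: lrho; case: (rho).
split.
  apply: wilf_equiv_dash_shift => //; try exact: all_range_leq.
  exact: all_range_pos sigmat.
(* Reverse complement puts the images of [tau] and [rho] in front, with the image of [sigma] shifted
   by their common largest letter [s]. The first equivalence applies, as these images are again
   Wilf-equivalent subword patterns. *)
move=> n k k1; rewrite -(avoid_count_dash_revcomp _ _ s0 t0 sigmat taus).
rewrite -(avoid_count_dash_revcomp _ _ s0 r0 sigmat rhos).
apply: wilf_equiv_dash_shift; rewrite ?size_revcomp //.
- exact: all_range_leq (all_revcomp taus).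
- exact: all_range_leq (all_revcomp rhos).
- exact: all_range_pos (all_revcomp sigmat).
- by move=> m l l1; rewrite !avoid_count_subword_revcomp // tr.
Qed.
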